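(* Let $G_1,\dots,G_n$ be finitely generated groups with finite generating sets $S_1,\dots,S_n$, and consider the Cayley graph of the free product $G_1*\cdots*G_n$ with respect to $\bigcup_{i=1}^n S_i$. Then $$p_{\mathrm{exp}}(G_1*\cdots*G_n)=\min_{1\le i\le n}\{p_{\mathrm{exp}}(G_i)\},$$ where $p_{\mathrm{exp}}(G_i)$ refers to the Cayley graph of $G_i$ with respect to $S_i$, and $p_{\mathrm{exp}}(G_i)$ is defined to be $1$ if $G_i$ is finite.
   Context: Cayley graph: for a group $G$ with finite generating set $S$, the graph has vertex set $G$, and $g,h$ are adjacent iff $g^{-1}h\in S$ or $h^{-1}g\in S$, with the appropriate multiplicity (one edge joining $g$ and $gs$ for each pair $(g,s)\in G\times S$). Bernoulli bond percolation with parameter $p\in[0,1]$ on a graph with vertex set $V$: each edge is independently open with probability $p$ and closed otherwise, with product measure $\mathrm{P}_p$. Write $x\leftrightarrow y$ for the event that $x$ and $y$ are joined by a path of open edges, and $\mathrm{dist}$ for the graph distance. Schonmann's critical point is $$p_{\mathrm{exp}}=\sup\{p\in[0,1]:\ \exists\, C,\gamma>0\ \ \forall x,y\in V\ \ \mathrm{P}_p(x\leftrightarrow y)\le Ce^{-\gamma\,\mathrm{dist}(x,y)}\}.$$ *)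

(* Defs.v *)
From HB Require Import structures.
From mathcomp Require Import all_boot all_order all_algebra finmap ring.
From mathcomp Require Import all_classical all_reals all_analysis.

Set Implicit Arguments.
Unset Strict Implicit.
Unset Printing Implicit Defensive.

Import Order.TTheory GRing.Theory Num.Theory.
Import numFieldNormedType.Exports.

Local Open Scope classical_set_scope.
Local Open Scope ring_scope.

(* Percolation configurations: w e = true means that the edge e is open. *)
Definition config (E : choiceType) : Type := E -> bool.

HB.instance Definition _ (E : choiceType) :=
  Pointed.copy (config E) (E -> bool).
HB.instance Definition _ (E : choiceType) :=
  Topological.copy (config E) (prod_topology (fun _ : E => bool)).

Section cylinder_sets.
Context {E : choiceType}.
Implicit Types (A B : set (config E)) (F : seq E) (w : config E).

(* Whether w belongs to A depends only on the values of w on F. *)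
Definition determined F A :=
  forall w w', {in F, w =1 w'} -> A w -> A w'.

Definition cylinder : set (set (config E)) :=
  [set A | exists F, determined F A].

Lemma sub_determined F F' A :
  {subset F <= F'} -> determined F A -> determined F' A.
Proof. by move=> FF' dA w w' ww'; apply: dA => e /FF'; exact: ww'. Qed.

Lemma determined0 F : determined F set0. Proof. by []. Qed.

Lemma determinedC F A : determined F A -> determined F (~` A).
Proof.
by move=> dA w w' ww' nAw Aw'; apply: nAw; apply: dA Aw' => e eF; rewrite ww'.
Qed.

Lemma determinedU F A B :
  determined F A -> determined F B -> determined F (A `|` B).
Proof.
by move=> dA dB w w' ww' [/(dA _ _ ww')|/(dB _ _ ww')]; [left|right].
Qed.

Lemma cylinder0 : cylinder set0.
Proof. by exists [::]; exact: determined0. Qed.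

Lemma cylinderU : setU_closed cylinder.
Proof.
move=> A B [F dA] [F' dB]; exists (F ++ F'); apply: determinedU.
- by apply: sub_determined dA => e eF; rewrite mem_cat eF.
- by apply: sub_determined dB => e eF; rewrite mem_cat eF orbT.
Qed.

Lemma cylinderC : setC_closed cylinder.
Proof. by move=> A [F dA]; exists F; exact: determinedC. Qed.

End cylinder_sets.

Definition cylinder_display : Type -> measure_display. Proof. exact. Qed.

HB.instance Definition _ (E : choiceType) :=
  @isAlgebraOfSets.Build (cylinder_display E) (config E) cylinder
    cylinder0 cylinderU cylinderC.

Section compactness.
Context {E : choiceType}.

Lemma cylinder_open (A : set (config E)) : cylinder A -> open A.
Proof.
move=> [F dA]; rewrite openE => w Aw; rewrite /interior.
have : nbhs (w : config E) (\bigcap_(e in [set` [fset e in F]%fset])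
   ((fun w' : config E => w' e) @^-1` [set w e])).
  apply: filter_bigI => /= e _.
  apply: (@proj_continuous E (fun=> bool) e w).
  by [].
apply: filterS => w' ww'; apply: dA Aw => e eF.
by rewrite (ww' e)//= !inE.
Qed.

Lemma config_compact : compact [set: config E].
Proof.
have := @tychonoff E (fun _ => bool) _ (fun=> bool_compact).
by congr (compact _); rewrite eqEsubset.
Qed.

Lemma cylinder_cover (A : set (config E)) (B : nat -> set (config E)) :
  cylinder A -> (forall i, cylinder (B i)) -> A `<=` \bigcup_i B i ->
  exists n, A `<=` \bigcup_(i < n) B i.
Proof.
move=> cA cB AB.
pose f (i : nat) : set (config E) := if i is j.+1 then B j else ~` A.
have := config_compact; rewrite compact_cover => /(_ nat setT f).
case.
- move=> [|i] _; apply: cylinder_open; last exact: cB.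
  exact: (cylinderC cA).
- move=> w _; have [/AB[i _ Biw]|nA] := pselect (A w).
    by exists i.+1.
  by exists 0%N.
move=> D _ DT; exists (\max_(i <- D) i)%N => w Aw.
have [] := DT w I; move=> [|i] /= iD //= Biw.
exists i => //=.
have iD' : i.+1 \in enum_fset D by [].
by rewrite (big_rem _ iD') /= leq_max leqnn.
Qed.

End compactness.

Section product_measure.
Context {R : realType} {E : choiceType}.
Variable Q : probability bool R.
Implicit Types (A B : set (config E)) (F : seq E) (w : config E).
Implicit Types f g : config E -> R.

Let q (b : bool) : R := fine (Q [set b]).

(* The content of a cylinder A determined by F is the integral of \1_A with
   respect to the coordinates in F (each distributed as Q); [avg e] integrates
   out the coordinate e. The result does not depend on F
   (cylinder_contentE). *)
Definition set_edge w e b : config E := fun e' => if e' == e then b else w e'.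

Definition avg e f : config E -> R :=
  fun w => q true * f (set_edge w e true) + q false * f (set_edge w e false).

Definition avgs F f := foldr avg f F.

Let q_ge0 b : 0 <= q b. Proof. exact: fine_ge0. Qed.

Let q_sum : q true + q false = 1.
Proof.
have := probability_setT Q; rewrite setT_bool measureU//; last first.
  by rewrite disjoints_subset => -[].
by move=> /(congr1 fine); rewrite fineD// fin_num_measure.
Qed.

Lemma avgC e e' f : avg e (avg e' f) = avg e' (avg e f).
Proof.
have [->//|ne] := eqVneq e e'.
have K w b b' : set_edge (set_edge w e b) e' b' =
    set_edge (set_edge w e' b') e b.
  apply/funext => x; rewrite /set_edge.
  by have [->|//] := eqVneq x e'; rewrite eq_sym (negbTE ne).
by apply/funext => w; rewrite /avg !K; ring.
Qed.

Lemma avgs_avg F e f : avgs F (avg e f) = avg e (avgs F f).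
Proof. by elim: F => //= e' F IH; rewrite IH avgC. Qed.

Lemma avgsC F F' f : avgs F (avgs F' f) = avgs F' (avgs F f).
Proof. by elim: F' => //= e F' <-; rewrite avgs_avg. Qed.

Lemma avgs_cst F c : avgs F (fun=> c) = fun=> c.
Proof.
elim: F => //= e F ->; apply/funext => w.
by rewrite /avg -mulrDl q_sum mul1r.
Qed.

Lemma avgs_ge0 F f : (forall w, 0 <= f w) -> forall w, 0 <= avgs F f w.
Proof.
move=> f0; elim: F => //= e F IH w.
by rewrite /avg addr_ge0// mulr_ge0.
Qed.

Lemma avgs_add F f g : avgs F (f \+ g) = avgs F f \+ avgs F g.
Proof.
elim: F => //= e F ->; apply/funext => w; rewrite /avg /=; ring.
Qed.

Lemma avgs_sum F n (h : nat -> config E -> R) w :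
  avgs F (fun w => \sum_(i < n) h i w) w = \sum_(i < n) avgs F (h i) w.
Proof.
elim: n => [|n IH].
  by under eq_fun do rewrite big_ord0; rewrite avgs_cst big_ord0.
under eq_fun do rewrite big_ord_recr /=.
by rewrite (avgs_add F (fun w => \sum_(i < n) h i w)) /= IH big_ord_recr.
Qed.

Lemma avgs_determined F f : (forall w w', {in F, w =1 w'} -> f w = f w') ->
  forall w w', avgs F f w = avgs F f w'.
Proof.
elim: F f => [|e F IH] f fF w w'; first exact: fF.
rewrite /= -!avgs_avg; apply: IH => {}w {}w' ww'; rewrite /avg.
congr (_ * _ + _ * _); apply: fF => e' /=;
  rewrite inE /set_edge; case: eqVneq => //= _; exact: ww'.
Qed.

Definition cylinder_content A : \bar R :=
  (avgs (xget [::] [set F | determined F A]) \1_A point)%:E.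

Lemma cylinder_contentE A F w : determined F A ->
  cylinder_content A = (avgs F \1_A w)%:E.
Proof.
move=> dA; rewrite /cylinder_content; congr (_%:E).
set F' := xget _ _.
have dA' : determined F' A by apply: (@xgetPex _ [::] [set F | determined F A]); exists F.
have K F0 : determined F0 A ->
    exists c, avgs F0 (\1_A : config E -> R) = fun=> c.
  move=> d0; exists (avgs F0 \1_A w); apply/funext => w'.
  apply: avgs_determined => v v' vv'; rewrite !indicE; congr (nat_of_bool _)%:R.
  by apply/idP/idP; rewrite !inE; apply: d0 => // e eF; rewrite vv'.
have [c Fc] := K _ dA; have [c' Fc'] := K _ dA'.
have := avgsC F F' (\1_A : config E -> R); rewrite Fc Fc' !avgs_cst.
by move=> /(congr1 (fun h => h w)).
Qed.

Lemma cylinder_content0 : cylinder_content set0 = 0%E.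
Proof.
rewrite (cylinder_contentE point (@determined0 _ [::]))/=.
by rewrite indicE in_set0.
Qed.

Lemma cylinder_content_ge0 A : (0 <= cylinder_content A)%E.
Proof. by rewrite lee_fin; apply: avgs_ge0 => w; rewrite indicE ler0n. Qed.

Lemma cylinder_content_additive n (B : nat -> set (config E)) :
  (forall i, cylinder (B i)) -> trivIset setT B ->
  cylinder_content (\bigcup_(i < n) B i) =
  (\sum_(i < n) cylinder_content (B i))%E.
Proof.
move=> cB tB.
pose F i := sval (cid (cB i)); have dF i : determined (F i) (B i) := svalP (cid (cB i)).
pose F' := flatten [seq F i | i <- iota 0 n].
have FF' i : (i < n)%N -> {subset F i <= F'}.
  move=> ni e eFi; apply/flattenP; exists (F i) => //.
  by apply: map_f; rewrite mem_iota.
have dB i : (i < n)%N -> determined F' (B i).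
  by move=> ni; apply: sub_determined (dF i); exact: FF'.
have dU : determined F' (\bigcup_(i < n) B i).
  by move=> w w' ww' [i /= ni Bi]; exists i => //; exact: dB ww' Bi.
rewrite (cylinder_contentE point dU).
rewrite (eq_bigr (fun i : 'I_n => (avgs F' \1_(B i) point)%:E)); last first.
  by move=> i _; apply: cylinder_contentE; exact: dB.
rewrite sumEFin; congr (_%:E).
rewrite -(avgs_sum F' n (fun i => \1_(B i) : config E -> R)).
congr (avgs F' _ _); apply/funext => w; rewrite indicE.
have [|nU] := boolP (w \in \bigcup_(i < n) B i).
  rewrite inE => -[i /= ni Biw].
  rewrite (bigD1 (Ordinal ni))//= indicE mem_set// big1 ?addr0// => j ji.
  rewrite indicE memNset// => Bjw.
  move/negP: ji; apply; apply/eqP/val_inj => /=.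
  by apply: (tB j i) => //; exists w.
rewrite big1// => i _; rewrite indicE memNset// => Biw.
by move/negP: nU; apply; rewrite inE; exists i => //=.
Qed.

Lemma cylinder_content_sigma_additive :
  semi_sigma_additive (cylinder_content : set (config E) -> \bar R).
Proof.
move=> B cB tB cU.
have [N UN] := cylinder_cover cU cB (@subset_refl _ _).
have B0 i : (N <= i)%N -> B i = set0.
  move=> Ni; rewrite -subset0 => w Biw.
  have [|j /= jN Bjw] := UN w; first by exists i.
  have ij : i = j by apply: tB => //; exists w.
  by move: jN; rewrite -ij ltnNge Ni.
apply: cvg_near_cst; exists N => // n /= Nn; rewrite big_mkord.
rewrite -cylinder_content_additive//; congr cylinder_content.
apply/seteqP; split => [w [i /= _ Biw]|w [i _ Biw]]; first by exists i.
have [|j /= jN Bjw] := UN w; first by exists i.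
by exists j => //=; exact: leq_trans Nn.
Qed.

HB.instance Definition _ := isMeasure.Build _ _ _ cylinder_content
  cylinder_content0 cylinder_content_ge0 cylinder_content_sigma_additive.

(* The product measure Q^E, on the sigma-algebra generated by the cylinders,
   by Caratheodory extension; product_measureE below gives its
   finite-dimensional marginals. *)
Definition product_measure := measure_extension cylinder_content.

HB.instance Definition _ := Measure.on product_measure.

Lemma product_measure_cylinder A : cylinder A ->
  product_measure A = cylinder_content A.
Proof. by move=> cA; rewrite /product_measure /measure_extension measurable_mu_extE. Qed.

Lemma product_measure_setT : product_measure setT = 1%E.
Proof.
have dT : determined [::] [set: config E] by [].
rewrite product_measure_cylinder; last by exists [::].
by rewrite (cylinder_contentE point dT)/= indicE in_setT.
Qed.

HB.instance Definition _ :=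
  Measure_isProbability.Build _ _ _ product_measure product_measure_setT.

Let hit (a : E -> bool) e : config E -> R := fun w => (w e == a e)%:R.

Let avgs_hit F a e f : e \notin F ->
  avgs F (hit a e \* f) = hit a e \* avgs F f.
Proof.
elim: F => //= e' F IH; rewrite inE negb_or => /andP[ee' /IH ->].
apply/funext => w; rewrite /avg /hit /set_edge /= (negbTE ee'); ring.
Qed.

Let avgs_pattern F a w : uniq F ->
  avgs F (\1_[set w : config E | {in F, w =1 a}] : config E -> R) w =
  \prod_(e <- F) q (a e).
Proof.
elim: F w => [|e F IH] w.
  by rewrite big_nil /= indicE mem_set.
rewrite cons_uniq => /andP[eF uF]; rewrite big_cons.
have -> : (\1_[set w : config E | {in e :: F, w =1 a}] : config E -> R) =
    hit a e \* (\1_[set w : config E | {in F, w =1 a}] : config E -> R).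
  apply/funext => v; rewrite /hit /= !indicE.
  have [ve|ve] := eqVneq (v e) (a e); last first.
    rewrite mul0r memNset//= => /(_ e (mem_head _ _)) /eqP.
    by rewrite (negbTE ve).
  rewrite mul1r; congr (nat_of_bool _)%:R; apply/idP/idP; rewrite !inE => va.
    by move=> e' e'F; apply: va; rewrite inE e'F orbT.
  by move=> e'; rewrite inE => /predU1P[->//|]; exact: va.
rewrite /= avgs_hit// /avg /hit /= !IH// /set_edge eqxx.
by case: (a e); rewrite /= ?mul0r ?mul1r mulr0 ?addr0 ?add0r.
Qed.

Lemma product_measureE F (a : E -> bool) : uniq F ->
  product_measure [set w : config E | {in F, w =1 a}] =
  (\prod_(e <- F) fine (Q [set a e]))%:E.
Proof.
move=> uF; set A := [set w | _].
have dA : determined F A.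
  by move=> w w' ww' wa e eF; rewrite -ww'// wa.
rewrite product_measure_cylinder; last by exists F.
by rewrite (cylinder_contentE point dA) avgs_pattern.
Qed.

End product_measure.

Section free_product.
Local Open Scope group_scope.
Context {I : choiceType} (G : I -> groupType).

Definition letter : choiceType := {i : I & G i}.

Implicit Types (x y : letter) (u v w : seq letter).

(* The free product is the set of reduced words: no letter is trivial and
   consecutive letters come from different factors. *)
Definition reduced w : bool :=
  all (fun x => tagged x != 1) w && sorted (fun x y => tag x != tag y) w.

Definition free_product := {w : seq letter | reduced w}.

HB.instance Definition _ := [isSub of free_product for @sval _ _].
HB.instance Definition _ := [Choice of free_product by <:].

Definition cons1 x w := if tagged x == 1 then w else x :: w.

(* Reduction of x :: w, when w is reduced. *)
Definition lmul x w :=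
  if w is y :: w' then
    if tag x == tag y then
      cons1 (Tagged G (tagged x * tagged_as x y)) w'
    else cons1 x w
  else cons1 x w.

Definition word_mul u v := foldr lmul v u.

Definition word_inv w :=
  rev [seq Tagged G (tagged x)^-1 | x : letter <- w].

Definition fresh i w := if w is y :: _ then i != tag y else true.

Lemma reduced_cons x w :
  reduced (x :: w) = [&& tagged x != 1, fresh (tag x) w & reduced w].
Proof.
rewrite /reduced /=; case: (tagged x != 1) => //=.
by case: w => //= y w; rewrite andbCA.
Qed.

Lemma lmul_fresh x w : fresh (tag x) w -> lmul x w = cons1 x w.
Proof. by case: w => //= y w /negbTE ->. Qed.

Lemma lmul_cons1 i (g h : G i) w : fresh i w ->
  lmul (Tagged G g) (cons1 (Tagged G h) w) = cons1 (Tagged G (g * h)) w.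
Proof.
move=> fw; rewrite [cons1 (Tagged G h) w]/cons1 /=; have [->|h1] := eqVneq h 1.
  by rewrite mulg1 lmul_fresh.
by rewrite /= eqxx tagged_asE.
Qed.

Lemma reduced_cons1 x w : fresh (tag x) w -> reduced w -> reduced (cons1 x w).
Proof. by rewrite /cons1; case: eqVneq => // x1 fw rw; rewrite reduced_cons x1 fw. Qed.

Lemma reduced_split i w : reduced w ->
  exists h : G i, exists2 w', fresh i w' && reduced w' & w = cons1 (Tagged G h) w'.
Proof.
case: w => [|[j h] w]; first by exists 1, [::]; rewrite /cons1 ?eqxx.
have [<-{i}|ij] := eqVneq j i.
  rewrite reduced_cons /= => /and3P[h1 fw rw]; exists h, w; first by rewrite fw.
  by rewrite /cons1 /= (negbTE h1).
by move=> rw; exists 1, (Tagged G h :: w); rewrite ?rw /cons1 /= ?eqxx// eq_sym ij.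
Qed.

Lemma reduced_lmul x w : reduced w -> reduced (lmul x w).
Proof.
case: x => i g /(reduced_split i)[h [w' /andP[fw rw] ->]].
by rewrite lmul_cons1// reduced_cons1.
Qed.

Lemma lmul1 i w : reduced w -> lmul (Tagged G (1 : G i)) w = w.
Proof.
move=> /(reduced_split i)[h [w' /andP[fw rw] ->]].
by rewrite lmul_cons1// mul1g.
Qed.

Lemma lmulM i (g h : G i) w : reduced w ->
  lmul (Tagged G g) (lmul (Tagged G h) w) = lmul (Tagged G (g * h)) w.
Proof.
move=> /(reduced_split i)[k [w' /andP[fw rw] ->]].
by rewrite !lmul_cons1// mulgA.
Qed.

Lemma lmul_reduced x w : reduced (x :: w) -> lmul x w = x :: w.
Proof.
rewrite reduced_cons => /and3P[x1 fw _].
by rewrite lmul_fresh// /cons1 (negbTE x1).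
Qed.

Lemma reduced_mul u v : reduced v -> reduced (word_mul u v).
Proof. by move=> rv; elim: u => //= x u; exact: reduced_lmul. Qed.

Lemma reduced_inv w : reduced w -> reduced (word_inv w).
Proof.
rewrite /reduced /word_inv all_rev all_map rev_sorted sorted_map.
move=> /andP[w1 sw]; apply/andP; split.
  by apply: sub_all w1 => x /=; rewrite invg_eq1.
by apply: sub_sorted sw => x y /=; rewrite eq_sym.
Qed.

Lemma word_mul_lmul x u v : reduced u -> reduced v ->
  word_mul (lmul x u) v = lmul x (word_mul u v).
Proof.
case: x => i g ru rv.
have [h [u' /andP[fu ru'] ->]] := reduced_split i ru.
have K (k : G i) :
    word_mul (cons1 (Tagged G k) u') v = lmul (Tagged G k) (word_mul u' v).
  rewrite /cons1 /=; case: eqVneq => [->|//].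
  by rewrite lmul1//; exact: reduced_mul.
by rewrite lmul_cons1// !K lmulM//; exact: reduced_mul.
Qed.

Lemma word_mulA u v w : reduced v -> reduced w ->
  word_mul u (word_mul v w) = word_mul (word_mul u v) w.
Proof.
move=> rv rw; elim: u => //= x u ->.
by rewrite word_mul_lmul//; exact: reduced_mul.
Qed.

Lemma word_mul1 w : reduced w -> word_mul w [::] = w.
Proof.
elim: w => //= x w IH rxw; have := rxw; rewrite reduced_cons => /and3P[_ _ /IH ->].
exact: lmul_reduced.
Qed.

Lemma word_mulV w : reduced w -> word_mul (word_inv w) w = [::].
Proof.
elim: w => //= -[i g] w IH rxw; have := rxw.
rewrite reduced_cons => /and3P[_ _ rw].
rewrite /word_inv /= rev_cons /word_mul foldr_rcons -(lmul_reduced rxw).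
by rewrite lmulM// mulVg lmul1//; exact: IH.
Qed.

Lemma word_invK : involutive word_inv.
Proof.
move=> w; rewrite /word_inv map_rev revK -map_comp -[RHS]map_id.
by apply: eq_map => -[i g] /=; rewrite invgK.
Qed.

Implicit Types a b c : free_product.

Definition fp_one : free_product := Sub [::] isT.
Definition fp_mul a b : free_product := Sub _ (reduced_mul (val a) (valP b)).
Definition fp_inv a : free_product := Sub _ (reduced_inv (valP a)).

Lemma fp_mulA : associative fp_mul.
Proof. by move=> a b c; apply/val_inj; apply: word_mulA; exact: valP. Qed.
Lemma fp_mul1g : left_id fp_one fp_mul.
Proof. by move=> a; apply/val_inj. Qed.
Lemma fp_mulg1 : right_id fp_one fp_mul.
Proof. by move=> a; apply/val_inj; apply: word_mul1; exact: valP. Qed.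
Lemma fp_mulVg : left_inverse fp_one fp_inv fp_mul.
Proof. by move=> a; apply/val_inj; apply: word_mulV; exact: valP. Qed.
Lemma fp_mulgV : right_inverse fp_one fp_inv fp_mul.
Proof.
move=> a; apply/val_inj; rewrite /= -[X in word_mul X]word_invK.
by apply: word_mulV; apply: reduced_inv; exact: valP.
Qed.

HB.instance Definition _ := isGroup.Build free_product
  fp_mulA fp_mul1g fp_mulg1 fp_mulVg fp_mulgV.

Definition embed i (g : G i) : free_product :=
  Sub _ (@reduced_lmul (Tagged G g) [::] isT).

Lemma embedM i : {morph @embed i : g h / g * h}.
Proof.
move=> g h; apply/val_inj.
rewrite -[RHS]/(word_mul (lmul _ [::]) _) word_mul_lmul//.
  exact: (esym (lmulM g h (isT : reduced [::]))).
exact: (@reduced_lmul (Tagged G h) [::] isT).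
Qed.

Lemma free_product_universal (H : groupType) (f : forall i, G i -> H) :
  (forall i, {morph f i : g h / g * h}) ->
  exists phi : free_product -> H,
    [/\ {morph phi : a b / a * b}, forall i g, phi (embed g) = f i g &
        forall psi : free_product -> H, {morph psi : a b / a * b} ->
          (forall i (g : G i), psi (embed g) = f i g) -> psi =1 phi].
Proof.
move=> fM.
have f1 i : f i 1 = 1 by apply: (mulgI (f i 1)); rewrite -fM !mulg1.
pose F w : H := \prod_(x <- w) f (tag x) (tagged x).
have Fcons1 x w : F (cons1 x w) = f (tag x) (tagged x) * F w.
  rewrite /cons1; case: eqVneq => [->|_]; first by rewrite f1 mul1g.
  by rewrite /F big_cons.
have Flmul x w : reduced w -> F (lmul x w) = f (tag x) (tagged x) * F w.
  case: x => i g /(reduced_split i)[h [w' /andP[fw rw] ->]].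
  by rewrite lmul_cons1// !Fcons1 fM mulgA.
have FM u w : reduced w -> F (word_mul u w) = F u * F w.
  move=> rw; elim: u => [|x u IH] /=; first by rewrite /F big_nil mul1g.
  by rewrite Flmul ?IH /F ?big_cons ?mulgA//; exact: reduced_mul.
exists (fun a => F (val a)); split => [a b|i g|psi psiM psif a].
- exact: FM (valP b).
- by rewrite [LHS](Flmul (Tagged G g) [::] isT) /F big_nil mulg1.
have psi1 : psi fp_one = 1 by apply: (mulgI (psi 1)); rewrite -psiM !mulg1.
case: a; elim=> [|[i g] w IH] rw.
  by rewrite /= /F big_nil -psi1; congr psi; exact/val_inj.
have /and3P[_ _ rw'] := etrans (esym (reduced_cons _ w)) rw.
have E : Sub (Tagged G g :: w) rw = embed g * (Sub w rw' : free_product).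
  apply/val_inj; rewrite -[RHS]/(word_mul (lmul _ [::]) w) word_mul_lmul//.
  exact: (esym (lmul_reduced rw)).
apply: (etrans (congr1 psi E)).
by rewrite psiM psif (IH rw' : psi (Sub w rw') = F w) /= /F big_cons.
Qed.

End free_product.

Arguments embed {I} G i g.

(* Loops and multiple edges are allowed; the pair [ends e] is only an
   orientation of the edge e, ignored by [adj]. *)
Record multigraph := Multigraph {
  vertex : Type;
  edge : choiceType;
  ends : edge -> vertex * vertex }.

Section walks.
Variable X : multigraph.
Implicit Types (O : set (edge X)) (x y : vertex X).

Definition adj O : rel (vertex X) := fun x y =>
  `[< exists2 e, O e & ends e = (x, y) \/ ends e = (y, x) >].

(* x :: s lists the vertices of a walk along edges in O, of length size s. *)
Definition is_walk O x y (s : seq (vertex X)) : Prop :=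
  path (adj O) x s /\ last x s = y.

(* Equal to +oo if x and y are in different components. *)
Definition dist (R : realType) x y : \bar R :=
  ereal_inf [set (size s)%:R%:E | s in is_walk setT x y].

Definition joined (w : config (edge X)) x y : Prop :=
  exists s, is_walk [set e | w e] x y s.

End walks.

Section percolation.
Variables (R : realType) (X : multigraph).

Definition percolation (p : R) := @product_measure R (edge X) (bernoulli_prob p).

Definition two_point (p : R) (x y : vertex X) : \bar R :=
  percolation p [set w | joined w x y].

Definition exp_decay (p : R) : Prop :=
  exists C gamma : R, [/\ 0 < C, 0 < gamma &
    forall x y : vertex X,
      (two_point p x y <= C%:E * expeR (- (gamma%:E * dist R x y)))%E].

Definition p_exp : R := sup [set p : R | 0 <= p <= 1 /\ exp_decay p].

End percolation.

Section cayley.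
Variable G : groupType.
Implicit Types S A : set G.

Definition subgroup A : Prop :=
  A 1%g /\ (forall g h, A g -> A h -> A (g * h^-1)%g).

Definition generates S : Prop := smallest subgroup S = setT.

Definition cayley S : multigraph :=
  @Multigraph G (G * S)%type (fun e => (e.1, (e.1 * val e.2)%g)).

(* p_exp of the Cayley graph, with the convention that it is 1 for a finite
   group. *)
Definition p_exp_group (R : realType) S : R :=
  if `[< finite_set [set: G] >] then 1 else p_exp R (cayley S).

End cayley.

(* Main.v *)
(* The copies of the factors in the free product are glued along cut vertices
   in a tree-like way, so the event that 1 is joined to the reduced word
   g_1 ... g_k forces 1 to be joined to g_j in the j-th copy for each j, and
   these events depend on disjoint sets of edges. Hence the two-point function
   at g_1 ... g_k is at most the product of the two-point functions at the g_j.
   For p < 1, exponential decay on G_i holds without a multiplicative constant,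
   because the two-point function is bounded away from 1 off the diagonal; the
   product then decays exponentially in the sum of the lengths of the g_j.
   Conversely, G_i embeds isometrically in the free product, so decay on the
   free product implies decay on G_i. On a finite factor there is decay at every
   p, which is the convention for finite groups. *)

Require Import Defs.
From mathcomp Require Import all_boot all_order all_algebra ring lra.
From mathcomp Require Import all_classical all_reals all_analysis.

Set Implicit Arguments.
Unset Strict Implicit.
Unset Printing Implicit Defensive.

Import Order.TTheory GRing.Theory Num.Theory.
Import numFieldNormedType.Exports.

Local Open Scope classical_set_scope.
Local Open Scope ring_scope.

(** * Cylinder events under the product measure *)

Section averages.
Context {R : realType} {E : choiceType}.
Variable Q : probability bool R.
Implicit Types (F : seq E) (f g : config E -> R) (w : config E).

Lemma product_measure_determined F (A : set (config E)) w : determined F A ->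
  product_measure Q A = (avgs Q F \1_A w)%:E.
Proof.
by move=> dA; rewrite product_measure_cylinder;
  [exact: cylinder_contentE|exists F].
Qed.

Lemma le_product_measure (A B : set (config E)) :
  A `<=` B -> (product_measure Q A <= product_measure Q B)%E.
Proof. exact: le_mu_ext. Qed.

Lemma avgs_cat F F' f : avgs Q (F ++ F') f = avgs Q F (avgs Q F' f).
Proof. exact: foldr_cat. Qed.

Lemma avgs_mull F f g : (forall e w b, e \in F -> f (set_edge w e b) = f w) ->
  avgs Q F (f \* g) = f \* avgs Q F g.
Proof.
elim: F => //= e F IH fF; rewrite IH => [|e' w b e'F]; last first.
  by apply: fF; rewrite inE e'F orbT.
apply/funext => w; rewrite /avg /= !fF ?mem_head//; ring.
Qed.

Lemma determined_set_edge F (A : set (config E)) e w b :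
  determined F A -> e \notin F -> \1_A (set_edge w e b) = \1_A w :> R.
Proof.
move=> dA eF; rewrite !indicE; congr (nat_of_bool _)%:R.
by apply/idP/idP; rewrite !inE; apply: dA => e' e'F; rewrite /set_edge;
  have [ee'|//] := eqVneq e' e; rewrite -ee' e'F in eF.
Qed.

(** Averaging over [F'] first treats [\1_A] as a constant and turns [\1_B] into a constant, which
    then factors out of the average over [F]. *)
Lemma product_measure_indep F F' (A B : set (config E)) :
  determined F A -> determined F' B -> (forall e, e \in F -> e \notin F') ->
  product_measure Q (A `&` B) = (product_measure Q A * product_measure Q B)%E.
Proof.
move=> dA dB FF'.
have dAB : determined (F ++ F') (A `&` B).
  by move=> w w' ww' [Aw Bw]; split; [apply: dA Aw|apply: dB Bw] => e eF;
    apply: ww'; rewrite mem_cat eF ?orbT.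
pose c := avgs Q F' (\1_B) (point : config E).
have Bc w : avgs Q F' (\1_B) w = c.
  apply: EFin_inj; rewrite -(product_measure_determined w dB).
  exact: product_measure_determined.
rewrite (product_measure_determined point dAB).
rewrite (product_measure_determined point dA).
rewrite (product_measure_determined point dB) -EFinM; congr (_%:E).
have -> : \1_(A `&` B) = \1_A \* \1_B :> (config E -> R) by rewrite indicI.
rewrite avgs_cat (@avgs_mull F'); last first.
  move=> e w b eF'; apply: (determined_set_edge _ _ dA).
  by apply: contraL eF' => /FF'.
have -> : avgs Q F' \1_B = fun=> c by apply/funext.
rewrite (_ : \1_A \* (fun=> c) = (fun=> c) \* \1_A); last first.
  by apply/funext => w /=; rewrite mulrC.
by rewrite avgs_mull//= mulrC.
Qed.

End averages.

(** * Marginals along an injection of edge sets *)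

Section marginal.
Context {R : realType} {E E' : choiceType} (Q : probability bool R).
Variables (phi : E' -> E) (phi_inj : injective phi).

Lemma avgs_marginal (F : seq E') (f : config E' -> R) w :
  avgs Q (map phi F) (fun w => f (w \o phi)) w = avgs Q F f (w \o phi).
Proof.
elim: F w => //= e F IH w; rewrite /avg !IH.
have K b : set_edge w (phi e) b \o phi = set_edge (w \o phi) e b.
  by apply/funext => e'; rewrite /set_edge /= (inj_eq phi_inj).
by rewrite !K.
Qed.

Lemma determined_marginal (F : seq E') (A : set (config E')) : determined F A ->
  determined (map phi F) [set w : config E | A (w \o phi)].
Proof.
by move=> dA w w' ww'; apply: dA => e eF; apply: ww'; exact: map_f.
Qed.

Lemma product_measure_marginal (F : seq E') (A : set (config E')) :
  determined F A ->
  product_measure Q [set w : config E | A (w \o phi)] = product_measure Q A.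
Proof.
move=> dA.
rewrite (product_measure_determined _ point (determined_marginal dA)).
rewrite (product_measure_determined _ ((point : config E) \o phi) dA).
rewrite -avgs_marginal.
by congr (avgs _ _ _ _)%:E; apply/funext => w; rewrite !indicE.
Qed.

End marginal.

(** * Monotonicity in the percolation parameter *)

Section monotonicity.
Context {R : realType} {E : choiceType}.
Implicit Types (F : seq E) (f g : config E -> R) (w : config E).

Lemma avg_bernoulli (p : R) e f w : 0 <= p <= 1 ->
  avg (bernoulli_prob p) e f w =
  p * f (set_edge w e true) + (1 - p) * f (set_edge w e false).
Proof.
move=> p01; rewrite /avg /= !bernoulli_probE// !diracE.
rewrite (mem_set (_ : [set true] true))// (mem_set (_ : [set false] false))//.
rewrite (memNset (_ : ~ [set true] false))//.
rewrite (memNset (_ : ~ [set false] true))//.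
by rewrite /= !(mulr1, mulr0, addr0, add0r).
Qed.

Definition increasing f := forall w w', (forall e, w e -> w' e) -> f w <= f w'.

Lemma increasing_avg (p : R) e f : 0 <= p <= 1 ->
  increasing f -> increasing (avg (bernoulli_prob p) e f).
Proof.
move=> p01 fi w w' ww'; rewrite !avg_bernoulli//.
have /andP[p0 p1] := p01.
by rewrite lerD// ler_wpM2l ?subr_ge0//; apply: fi => e'; rewrite /set_edge;
  case: eqVneq => // _; exact: ww'.
Qed.

Lemma le_avgs (p p' : R) F f w : 0 <= p <= 1 -> 0 <= p' <= 1 -> p <= p' ->
  increasing f ->
  avgs (bernoulli_prob p) F f w <= avgs (bernoulli_prob p') F f w.
Proof.
move=> p01 p'01 pp' fi.
have avgs_incr F' : increasing (avgs (bernoulli_prob p') F' f).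
  by elim: F' => //= e F'; exact: increasing_avg.
elim: F w => //= e F IH w.
rewrite !avg_bernoulli//; have /andP[p0 p1] := p01.
set g := avgs _ F f; set g' := avgs _ F f.
(* The parameter of the inner averages changes first and that of [e] second; the second change
   raises the value because [g'] is increasing. *)
apply: (@le_trans _ _ (p * g' (set_edge w e true) +
    (1 - p) * g' (set_edge w e false))).
  by rewrite lerD// ler_wpM2l ?subr_ge0//; exact: IH.
have : g' (set_edge w e false) <= g' (set_edge w e true).
  by apply: avgs_incr => e'; rewrite /set_edge; case: ifP.
nra.
Qed.

Lemma le_product_measure_bernoulli (p p' : R) F (A : set (config E)) :
  0 <= p <= 1 -> 0 <= p' <= 1 -> p <= p' -> determined F A ->
  (forall w w' : config E, (forall e, w e -> w' e) -> A w -> A w') ->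
  (product_measure (bernoulli_prob p) A <=
   product_measure (bernoulli_prob p') A)%E.
Proof.
move=> p01 p'01 pp' dA Ai.
rewrite !(product_measure_determined _ point dA) lee_fin le_avgs// => w w' ww'.
rewrite !indicE ler_nat; case: (boolP (w \in A)) => //; rewrite inE => Aw.
by rewrite mem_set//; exact: Ai Aw.
Qed.

End monotonicity.

(** * Walks and two-point functions *)

Section walk_transport.
Variables X Y : multigraph.

(** The first alternative lets [f] contract edges, so that the lemma serves retractions as well as
    embeddings; contracted edges shorten the walk. *)
Lemma walk_map (OX : set (edge X)) (OY : set (edge Y))
    (f : vertex X -> vertex Y) :
  (forall e, OX e -> f (ends e).1 = f (ends e).2 \/
     exists2 e', OY e' & ends e' = (f (ends e).1, f (ends e).2)) ->
  forall x y s, is_walk OX x y s ->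
  exists2 s', is_walk OY (f x) (f y) s' & (size s' <= size s)%N.
Proof.
move=> fO x y s; elim: s x => [|z s IH] x [/=].
  by move=> _ <-; exists [::].
move=> /andP[/asboolP[e Oe exz] zs] sy.
have [s' [ps' ls'] s's] := IH z (conj zs sy).
have [fxz|[e' Oe' e'xz]] := fO e Oe.
  have fxfz : f x = f z by case: exz fxz => ->.
  by exists s'; [rewrite fxfz|exact: leqW].
exists (f z :: s') => //; split => //=; rewrite ps' andbT.
apply/asboolP; exists e' => //.
by case: exz e'xz => -> /= ->; [left|right].
Qed.

Lemma joined_map (v : config (edge X)) (w : config (edge Y))
    (f : vertex X -> vertex Y) :
  (forall e, v e -> f (ends e).1 = f (ends e).2 \/
     exists2 e', w e' & ends e' = (f (ends e).1, f (ends e).2)) ->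
  forall x y, joined v x y -> joined w (f x) (f y).
Proof.
move=> fvw x y [s xys].
have [s' xys' _] :=
  walk_map (OX := [set e | v e]) (OY := [set e | w e]) fvw xys.
by exists s'.
Qed.

End walk_transport.

(** Countability of the edge set, in the form that writes a connection event as an increasing union
    of cylinders. *)
Definition exhaustible (E : choiceType) := exists F : nat -> seq E,
  (forall n, {subset F n <= F n.+1}) /\ forall e, exists n, e \in F n.

Section graph_facts.
Variable X : multigraph.
Implicit Types (O : set (edge X)) (x y : vertex X) (v w : config (edge X)).

Lemma sub_joined v w x y :
  (forall e, v e -> w e) -> joined v x y -> joined w x y.
Proof.
move=> vw; apply: (@joined_map _ _ v w id) => e /vw we; right; exists e => //.
by case: (ends e).
Qed.

Definition at_dist x y (n : nat) :=
  (exists2 s, is_walk setT x y s & size s = n) /\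
  forall s, is_walk setT x y s -> (n <= size s)%N.

Lemma dist_at_dist (R : realType) x y n : at_dist x y n -> dist R x y = n%:R%:E.
Proof.
move=> [[s xys <-] smin]; apply/eqP; rewrite eq_le; apply/andP; split.
  by apply: ereal_inf_lbound; exists s.
apply: le_ereal_inf_tmp => _ [s' xys' <-].
by rewrite lee_fin ler_nat smin.
Qed.

Lemma at_dist_exists x y s : is_walk setT x y s -> exists n, at_dist x y n.
Proof.
move=> xys.
have ex : exists n, `[< exists2 s, is_walk setT x y s & size s = n >].
  by exists (size s); apply/asboolP; exists s.
case: (ex_minnP ex) => n /asboolP[s' xys' s'n] nmin.
exists n; split => [|r xyr]; first by exists s'.
by apply: nmin; apply/asboolP; exists r.
Qed.

Lemma adj_sym O : symmetric (adj O).
Proof.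
by move=> x y; apply: asbool_equiv_eq; split => -[e Oe [exy|exy]];
  exists e; tauto.
Qed.

Lemma walk_rev O x y s : is_walk O x y s -> exists s', is_walk O y x s'.
Proof.
move=> [ps ls]; exists (rev (belast x s)); split.
  by rewrite -ls rev_path; under eq_path do rewrite adj_sym.
by case: s ps ls => [|z s] //= _ _; rewrite rev_cons last_rcons.
Qed.

Lemma walk_cat O x y z s t : is_walk O x y s -> is_walk O y z t ->
  is_walk O x z (s ++ t).
Proof.
move=> [ps <-] [pt lt]; split; last by rewrite last_cat.
by rewrite cat_path ps pt.
Qed.

End graph_facts.

(** When [F] is a finite list, closing the edges outside it turns connection into a cylinder event,
    to which finite averages apply. *)
Definition restrict_config (E : choiceType) (F : {pred E}) (w : config E) :
    config E :=
  fun e => w e && (e \in F).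

Lemma determined_restrict (E : choiceType) (F : seq E) (P : config E -> Prop) :
  determined F [set w | P (restrict_config (mem F) w)].
Proof.
move=> w w' ww' /=; congr P; apply/funext => e; rewrite /restrict_config.
by case: (boolP (e \in mem F)); rewrite ?andbF ?andbT => // /ww'.
Qed.

Section two_point_facts.
Variables (R : realType) (X : multigraph).
Implicit Types (p : R) (x y : vertex X) (v w : config (edge X)).

Lemma two_point_ge (F : {pred edge X}) p x y :
  (percolation p [set w : config (edge X) | joined (restrict_config F w) x y] <=
   two_point p x y)%E.
Proof.
apply: le_product_measure => w; apply: sub_joined => e.
by rewrite /restrict_config => /andP[].
Qed.

Lemma joined_finite w x y (F : nat -> seq (edge X)) :
  (forall n, {subset F n <= F n.+1}) -> (forall e, exists n, e \in F n) ->
  joined w x y -> exists n, joined (restrict_config (mem (F n)) w) x y.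
Proof.
move=> Fmono Fcover.
have Fle m n : (m <= n)%N -> {subset F m <= F n}.
  move=> /subnK <-; elim: (n - m)%N => //= k IH e /IH; exact: Fmono.
case=> s; elim: s x => [|z s IH] x [/=].
  by move=> _ <-; exists 0%N, [::].
move=> /andP[/asboolP[e Oe exz] zs] sy.
have [n zyn] := IH z (conj zs sy); have [m em] := Fcover e.
have [r zyr] : joined (restrict_config (mem (F (maxn m n))) w) z y.
  apply: sub_joined zyn => e'; rewrite /restrict_config => /andP[-> /=].
  exact/Fle/leq_maxr.
exists (maxn m n), (z :: r); case: zyr => pr lr; split => //=; rewrite pr andbT.
apply/asboolP; exists e => //=; rewrite /restrict_config Oe.
exact/(Fle _ _ (leq_maxl _ _)).
Qed.

(** A walk uses finitely many edges, so the connection event is the increasing union of its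
    restrictions along the exhaustion, and continuity from below applies. Upper bounds then only
    have to be checked on cylinders. *)
Lemma two_point_le p x y (b : \bar R) : exhaustible (edge X) ->
  (forall F : seq (edge X), percolation p
     [set w : config (edge X) | joined (restrict_config (mem F) w) x y] <=
   b)%E ->
  (two_point p x y <= b)%E.
Proof.
move=> [F [Fmono Fcover]] Fb; rewrite /two_point.
pose A n := [set w : config (edge X) |
  joined (restrict_config (mem (F n)) w) x y].
have -> : [set w : config (edge X) | joined w x y] = \bigcup_n A n.
  apply/seteqP; split => w /=.
    by move=> /(joined_finite Fmono Fcover)[n wn]; exists n.
  by move=> [n _]; apply: sub_joined => e /andP[].
have mA n : measurable
    (A n : set (g_sigma_algebraType (cylinder_display (edge X)).-measurable)).
  apply: sub_sigma_algebra; exists (F n).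
  exact: (determined_restrict (P := fun w => joined w x y)).
have Amono : {homo A : n m / (n <= m)%N >-> (n <= m)%O}.
  apply: homo_leq => [B||n]; [exact: lexx|by move=> B C D; exact: le_trans|].
  apply/subsetPset => w; apply: sub_joined => e /andP[we /Fmono eF].
  exact/andP.
have Acvg : percolation p (A n) @[n --> \oo] --> percolation p (\bigcup_n A n).
  by apply: nondecreasing_cvg_mu => //; exact: bigcupT_measurable.
rewrite -(cvg_lim _ Acvg)//; apply: lime_le.
  by apply/cvg_ex; eexists; exact: Acvg.
by apply: nearW => n; exact: Fb.
Qed.

Lemma two_point_ge0 p x y : (0 <= two_point p x y)%E.
Proof. exact: measure_ge0. Qed.

Lemma two_point_le1 p x y : (two_point p x y <= 1)%E.
Proof.
rewrite -(@product_measure_setT _ (edge X) (bernoulli_prob p)).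
exact: le_product_measure.
Qed.

Lemma two_point_mono p p' x y : exhaustible (edge X) ->
  0 <= p <= 1 -> 0 <= p' <= 1 -> p <= p' ->
  (two_point p x y <= two_point p' x y)%E.
Proof.
move=> EX p01 p'01 pp'; apply: two_point_le => // F.
apply: le_trans (two_point_ge (mem F) p' x y).
apply: (@le_product_measure_bernoulli _ _ p p' F) => //.
  exact: (determined_restrict (P := fun w => joined w x y)).
by move=> w w' ww'; apply: sub_joined => e /andP[/ww' we eF]; apply/andP.
Qed.

(** An open walk that leaves [x] starts with an open edge of [D], and all edges of [D] are closed
    with probability [(1 - p) ^+ size D]. *)
Lemma two_point_isolated p x y (D : seq (edge X)) : 0 <= p <= 1 ->
  uniq D -> x <> y ->
  (forall e, (ends e).1 = x \/ (ends e).2 = x -> e \in D) ->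
  (two_point p x y <= (1 - (1 - p) ^+ size D)%:E)%E.
Proof.
move=> p01 uD xy xD.
pose A := [set w : config (edge X) | {in D, w =1 fun=> false}].
have mA : measurable
    (A : set (g_sigma_algebraType (cylinder_display (edge X)).-measurable)).
  apply: sub_sigma_algebra; exists D => w w' ww' Aw e eD.
  by rewrite -ww'// Aw.
have PA : percolation p A = ((1 - p) ^+ size D)%:E.
  rewrite [LHS](product_measureE _ _ uD) big_const_seq count_predT iter_mulr_1.
  rewrite /= bernoulli_probE// !diracE.
  rewrite (mem_set (_ : [set false] false))//.
  rewrite (memNset (_ : ~ [set false] true))//.
  by rewrite /= mulr0 mulr1 add0r.
have -> : ((1 - (1 - p) ^+ size D)%:E = percolation p (~` A))%E.
  by rewrite /percolation (probability_setC _ mA) EFinB -PA.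
apply: le_product_measure => w [[|z s] [/= ps ls]] Aw; first exact: xy.
have /andP[/asboolP[e we exz] _] := ps.
have : e \in D by apply: xD; case: exz => ->; [left|right].
by move=> /Aw we0; move: we => /=; rewrite we0.
Qed.

End two_point_facts.

(** The states of the edges in the image of [phi] are distributed as percolation on [Y], and an open
    walk in [Y] maps to an open walk in [X]. *)
Lemma two_point_map (R : realType) (X Y : multigraph)
    (f : vertex Y -> vertex X) (phi : edge Y -> edge X) (p : R) x y :
  exhaustible (edge Y) -> injective phi ->
  (forall e, ends (phi e) = (f (ends e).1, f (ends e).2)) ->
  (two_point p x y <= two_point p (f x) (f y))%E.
Proof.
move=> EY phiI phiE; apply: two_point_le => // F.
rewrite /percolation -(product_measure_marginal _ phiI (F := F)); last first.
  exact: (determined_restrict (P := fun w => joined w x y)).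
apply: le_product_measure => w; apply: joined_map => e /andP[we _].
by right; exists (phi e).
Qed.

(** * Cayley graphs *)

Lemma finite_set_enum (T : choiceType) (S : set T) : finite_set S ->
  exists D : seq S, forall s : S, s \in D.
Proof.
move=> /finite_seqP[s Ss]; exists (pmap insub s) => u.
have sS : S `<=` [set` s] by rewrite -Ss.
by rewrite mem_pmap_sub; exact/sS/set_mem/valP.
Qed.

Section cayley_facts.
Local Open Scope group_scope.
Variables (G : groupType) (S : set G).
Hypotheses (finS : finite_set S) (genS : generates S).

Lemma cayley_connected (x y : G) : exists s, @is_walk (cayley S) setT x y s.
Proof.
(* Walks are required from every [x], not only from 1, so that closure under [g * h^-1] is mere
   concatenation and reversal. *)
pose A : set G := [set g |
  forall x, exists s, @is_walk (cayley S) setT x (x * g) s].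
have subA : subgroup A.
  split=> [x'|g h Ag Ah x']; first by exists [::]; split => //=; rewrite mulg1.
  have [s xs] := Ag x'; have [s' /walk_rev[t xt]] := Ah (x' * g * h^-1).
  exists (s ++ t); rewrite mulgA; apply: walk_cat xs _.
  by move: xt; rewrite mulgVK.
have SA : S `<=` A.
  move=> g Sg x'; exists [:: x' * g]; split => //=; rewrite andbT.
  by apply/asboolP; exists (x', SigSub (mem_set Sg) : S) => //; left.
have : setT `<=` A by rewrite -genS; exact: smallest_sub.
by move=> /(_ (x^-1 * y) I x); rewrite mulVKg.
Qed.

Lemma cayley_exhaustible : exhaustible (edge (cayley S)).
Proof.
have [D DS] := finite_set_enum finS.
(* [B n] lists the ball of radius [n] about 1, with repetitions; [S] need not be symmetric, so edges
   are followed in both directions. *)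
pose B n : seq G := iter n (fun b => b ++
  ([seq g * val s | g <- b, s <- D] ++
   [seq g * (val s)^-1 | g <- b, s <- D])) [:: 1].
have Bmono n : {subset B n <= B n.+1} by move=> g; rewrite /= mem_cat => ->.
have Bwalk s : forall n x y, x \in B n -> @is_walk (cayley S) setT x y s ->
    y \in B (n + size s)%N.
  elim: s => [|z s IH] n x y xB [/=]; first by move=> _ <-; rewrite addn0.
  move=> /andP[/asboolP[[g t] _ /= exz] zs] sy.
  rewrite addnS -addSn; apply: (IH n.+1 z y) => //.
  rewrite /= !mem_cat; apply/orP; right; apply/orP; case: exz => -[gx gtz].
    by left; rewrite -gtz gx; apply: allpairs_f.
  by right; rewrite -gx -[X in X \in _](mulgK (val t)) gtz; apply: allpairs_f.
exists (fun n => [seq (g, s) | g <- B n, s <- D]); split.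
  move=> n [g s] /allpairsP[[g' s'] /= [g'B s'D ->]].
  by apply: allpairs_f => //; exact: Bmono.
move=> [g s]; have [r] := cayley_connected 1 g.
move=> /(Bwalk _ 0%N); rewrite /= inE => /(_ (eqxx _)) gB.
by exists (size r); apply: allpairs_f.
Qed.

Lemma translate_two_point (R : realType) (p : R) (a x y : G) :
  (@two_point R (cayley S) p x y <=
   @two_point R (cayley S) p (a * x)%g (a * y)%g)%E.
Proof.
apply: (@two_point_map _ (cayley S) (cayley S) (fun x => a * x)
  (fun e => (a * e.1, e.2))); first exact: cayley_exhaustible.
- by move=> [g s] [h t] [/mulgI -> ->].
- by move=> [g s] /=; rewrite mulgA.
Qed.

Lemma translate_walk (a x y : G) s : @is_walk (cayley S) setT x y s ->
  exists2 s', @is_walk (cayley S) setT (a * x) (a * y) s' &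
    (size s' <= size s)%N.
Proof.
apply: (@walk_map (cayley S) (cayley S) setT setT (fun x => a * x)) => -[g t] _.
by right; exists (a * g, t) => //=; rewrite mulgA.
Qed.

(* The default 0 is never used when S generates G. *)
Definition word_length (g : G) : nat :=
  xget 0%N [set n | @at_dist (cayley S) 1 g n].

Lemma at_dist_word_length g : @at_dist (cayley S) 1 g (word_length g).
Proof.
have [s gs] := cayley_connected 1 g; have [n gn] := at_dist_exists gs.
by rewrite /word_length; case: xgetP => [m ->//|/(_ n)].
Qed.

Lemma word_length_le g s : @is_walk (cayley S) setT 1 g s ->
  (word_length g <= size s)%N.
Proof. by case: (at_dist_word_length g) => _; apply. Qed.

Lemma word_length1 : word_length 1 = 0%N.
Proof. by apply/eqP; rewrite -leqn0; apply: (@word_length_le 1 [::]). Qed.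

Lemma word_lengthM g h :
  (word_length (g * h) <= word_length g + word_length h)%N.
Proof.
have [[s gs <-] _] := at_dist_word_length g.
have [[t ht <-] _] := at_dist_word_length h.
have [t' ht' t't] := translate_walk g ht.
rewrite mulg1 in ht'.
apply: leq_trans (word_length_le (walk_cat gs ht')) _.
by rewrite size_cat leq_add2l.
Qed.

Lemma dist_word_length (R : realType) (x y : G) :
  @dist (cayley S) R x y = (word_length (x^-1 * y))%:R%:E.
Proof.
apply: dist_at_dist; have [[s ws sl] _] := at_dist_word_length (x^-1 * y).
have [s' ws' s's] := translate_walk x ws; rewrite mulg1 mulVKg in ws'.
have lower r : @is_walk (cayley S) setT x y r ->
    (word_length (x^-1 * y) <= size r)%N.
  move=> /(translate_walk x^-1)[r']; rewrite mulVg => /word_length_le.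
  exact: leq_trans.
split=> //; exists s' => //; apply/eqP.
by rewrite eqn_leq lower// -sl s's.
Qed.

(** Left translations are automorphisms, so one endpoint can be moved to 1. *)
Lemma exp_decay_cayleyP (R : realType) (p : R) : exp_decay (cayley S) p <->
  exists C gamma : R, [/\ (0 < C)%R, (0 < gamma)%R & forall g : G,
    (@two_point R (cayley S) p 1%g g <=
     (C * expR (- (gamma * (word_length g)%:R)))%:E)%E].
Proof.
split=> -[C [gamma [C0 gamma0 decay]]]; exists C, gamma; split => //.
  by move=> g; rewrite (le_trans (decay _ _))// dist_word_length invg1 mul1g.
move=> x y; rewrite dist_word_length.
apply: le_trans (decay _); rewrite -(mulVg x).
exact: translate_two_point.
Qed.

Lemma exp_decay_finite (R : realType) (p : R) :
  finite_set [set: G] -> exp_decay (cayley S) p.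
Proof.
move=> /finite_seqP[D GD]; apply/exp_decay_cayleyP.
pose m := (\max_(g <- D) word_length g)%N.
(* Word lengths are at most [m], so with these constants the bound is at least 1 everywhere,
   whatever [p] is. *)
exists (expR m%:R), 1%R; split => [||g]; rewrite ?expR_gt0//.
rewrite (le_trans (two_point_le1 _ _ _))// lee_fin mul1r -expRD.
rewrite -[leLHS]expR0 ler_expR subr_ge0 ler_nat.
apply: leq_bigmax_seq => //.
by have : [set: G] g by []; rewrite GD.
Qed.

Lemma two_point_lt1 (R : realType) (p : R) : (0 <= p < 1)%R ->
  exists2 eps : R, (0 < eps)%R & forall g : G, g != 1 ->
    (@two_point R (cayley S) p 1%g g <= (1 - eps)%:E)%E.
Proof.
move=> /andP[p0 p1]; have [D DS] := finite_set_enum finS.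
(* The edges that start or end at 1; a loop from a trivial generator occurs in both lists, hence
   [undup]. *)
pose B : seq (edge (cayley S)) :=
  undup ([seq (1, s) | s <- D] ++ [seq ((val s)^-1, s) | s <- D]).
exists ((1 - p) ^+ size B)%R => [|g /eqP g1].
  by rewrite exprn_gt0 ?subr_gt0.
apply: two_point_isolated;
  [by rewrite p0 (ltW p1)|exact: undup_uniq|exact/nesym|].
move=> [h s] /= hs; rewrite mem_undup mem_cat; apply/orP.
case: hs => [->|hs1]; [left|right]; first exact: map_f.
have -> : h = (val s)^-1 by apply: (mulIg (val s)); rewrite mulVg.
exact: map_f.
Qed.

(* Away from the origin the two-point function is bounded away from 1, so
   interpolating with this bound absorbs the constant of the decay. *)
Lemma exp_decay_constant1 (R : realType) (p : R) : (0 <= p < 1)%R ->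
  exp_decay (cayley S) p -> exists2 gamma : R, (0 < gamma)%R & forall g : G,
    (@two_point R (cayley S) p 1%g g <=
     (expR (- (gamma * (word_length g)%:R)))%:E)%E.
Proof.
move=> p01 /exp_decay_cayleyP[C [gamma [C0 gamma0 decay]]].
have [eps eps0 far] := two_point_lt1 p01.
(* The maximum with 1 makes [b] nonnegative, so that [theta] is at most 1. *)
pose b := ln (Num.max C 1)%R.
have C1 : (1 <= Num.max C 1)%R by rewrite le_max lexx orbT.
have b0 : (0 <= b)%R by exact: ln_ge0.
(* This weight solves [(1 - theta) * eps = theta * b]: in the convex combination of the bounds
   [- eps] and [b - gamma * d] on the logarithm, the constants cancel. *)
pose theta := (eps / (eps + b))%R.
have epsb : (0 < eps + b)%R by rewrite ltr_pwDl.
have th0 : (0 < theta)%R by rewrite divr_gt0.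
have th1 : (theta <= 1)%R by rewrite ler_pdivrMr// mul1r lerDl.
exists (theta * gamma)%R => [|g]; first exact: mulr_gt0.
have [->|g1] := eqVneq g 1.
  by rewrite word_length1 mulr0 oppr0 expR0 two_point_le1.
have tfin : @two_point R (cayley S) p 1 g \is a fin_num.
  by rewrite fin_real// (lt_le_trans _ (two_point_ge0 _ _ _))//
    (le_lt_trans (two_point_le1 _ _ _))// ltry.
have := two_point_ge0 p (1 : vertex (cayley S)) g.
have := far g g1; have := decay g.
rewrite -(fineK tfin) !lee_fin; set t := fine _ => tdecay tfar.
rewrite le_eqVlt => /predU1P[<-|t0]; first exact: expR_ge0.
rewrite -[leLHS](lnK t0) ler_expR; set d := (word_length g)%:R.
have L1 : (ln t <= - eps)%R.
  rewrite -ler_expR lnK// (le_trans tfar)//; exact: expR_ge1Dx.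
have L2 : (ln t <= b - gamma * d)%R.
  rewrite -ler_expR lnK// (le_trans tdecay)// expRD lnK; last first.
    by rewrite posrE (lt_le_trans ltr01).
  by rewrite ler_wpM2r ?expR_ge0// le_max lexx.
have -> : (- (theta * gamma * d) =
    (1 - theta) * - eps + theta * (b - gamma * d))%R.
  rewrite /theta; field; exact: lt0r_neq0.
have -> : ln t = ((1 - theta) * ln t + theta * ln t)%R by ring.
by rewrite lerD// ler_wpM2l// ?subr_ge0// ltW.
Qed.

End cayley_facts.

(** * Free products *)

Section first_letter.
Local Open Scope group_scope.
Context {I : choiceType} (G : I -> groupType).
Implicit Types (a b : free_product G) (v w : seq (letter G)).

Lemma word_mul_cons1 i (g : G i) v w : reduced w ->
  word_mul (cons1 (Tagged G g) v) w = lmul (Tagged G g) (word_mul v w).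
Proof.
move=> rw; rewrite /cons1 /=; case: eqVneq => [->|//].
by rewrite lmul1//; exact: reduced_mul.
Qed.

Lemma embed_mulE i (g : G i) a : fresh i (val a) ->
  val (embed G i g * a) = cons1 (Tagged G g) (val a).
Proof.
move=> fa; rewrite -[LHS]/(word_mul (cons1 (Tagged G g) [::]) (val a)).
by rewrite word_mul_cons1 ?lmul_fresh//; exact: valP.
Qed.

Lemma embed1 i : embed G i 1 = 1.
Proof. by apply: (mulgI (embed G i 1)); rewrite -embedM !mulg1. Qed.

Lemma free_productP i a : exists g : G i, exists2 b, fresh i (val b) &
  a = embed G i g * b.
Proof.
have [g [w /andP[fw rw] aw]] := reduced_split i (valP a).
exists g, (Sub w rw) => //; apply: val_inj; rewrite embed_mulE//.
Qed.

Lemma free_product_ind (P : free_product G -> Prop) : P 1 ->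
  (forall i (g : G i) a, g != 1 -> fresh i (val a) -> P a ->
     P (embed G i g * a)) ->
  forall a, P a.
Proof.
move=> P1 PM [w rw]; elim: w rw => [|[i g] w IH] rw.
  have -> // : exist (fun w => reduced w) _ rw = 1 :> free_product G.
  exact: val_inj.
have := rw; rewrite reduced_cons => /and3P[/= g1 fw rw'].
have -> : exist (fun w => reduced w) _ rw =
    embed G i g * Sub w rw' :> free_product G.
  by apply: val_inj; rewrite embed_mulE// /cons1 (negbTE g1).
by apply: PM => //; exact: IH.
Qed.

(** The retraction onto the copy of [G i] through 1, collapsing what hangs at [embed G i g] to [g].
    The default of [tagged_as] gives 1 when the word starts in another factor. *)
Definition first_letter i a : G i :=
  if val a is x :: _ then tagged_as (Tagged G (1 : G i)) x else 1.

Lemma first_letter_embedM i (g : G i) a : fresh i (val a) ->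
  first_letter i (embed G i g * a) = g.
Proof.
move=> fa; rewrite /first_letter embed_mulE// /cons1 /=.
have [->|_] := eqVneq g 1; last by rewrite tagged_asE.
case: a fa => -[|x w] //= _ ix.
by rewrite /tagged_as; case: eqP ix => //= ->; rewrite eqxx.
Qed.

Lemma first_letter_embed i (g : G i) : first_letter i (embed G i g) = g.
Proof. by rewrite -[embed _ _ _]mulg1 first_letter_embedM. Qed.

Lemma first_letter1 i : first_letter i 1 = 1.
Proof. by []. Qed.

Lemma embed_inj i : injective (embed G i).
Proof.
by move=> g h gh; rewrite -(first_letter_embed g) gh first_letter_embed.
Qed.

(** The letter [y] can merge with [x] only if [x] is the whole word; the product then is empty or
    starts in the factor of [x]. In a longer word [x] stays in front, by induction on the tail. *)
Lemma fresh_mul_letter i x w (y : letter G) : reduced (x :: w) ->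
  i != tag x -> fresh i (word_mul (x :: w) (cons1 y [::])).
Proof.
elim: w i x => [|z w IH] i x.
  case: x y => k h [j s]; rewrite reduced_cons /= andbT => h1 ik.
  rewrite /cons1 /=; case: eqVneq => _ /=.
    by rewrite /cons1 /= (negbTE h1).
  by case: eqP => ?; rewrite /cons1 /= ?(negbTE h1)//; case: ifP.
rewrite reduced_cons => /and3P[x1 xz rw] ix.
rewrite -[word_mul _ _]/(lmul x (word_mul (z :: w) (cons1 y [::]))).
by rewrite lmul_fresh ?IH// /cons1 (negbTE x1).
Qed.

(* Right multiplication by a letter changes the component in G i only inside
   the copy of G i through 1: the copies are attached at cut vertices. *)
Lemma first_letter_mul i a j (s : G j) :
  first_letter i (a * embed G j s) = first_letter i a \/
  i = j /\ a = embed G i (first_letter i a).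
Proof.
have [g [b fb ->]] := free_productP i a.
rewrite first_letter_embedM//.
have [bs|nbs] := boolP (fresh i (val (b * embed G j s))).
  by left; rewrite -mulgA first_letter_embedM.
(* If multiplying [b] by the letter produces a word starting in [G i], then [b] is trivial by
   [fresh_mul_letter], and the letter itself lies in [G i]. *)
right; case: b fb nbs => -[|x w] rw /= fb nbs; last first.
  by move: nbs; rewrite (@fresh_mul_letter i x w (Tagged G s)).
have -> : exist (fun w => reduced w) [::] rw = 1 :> free_product G.
  exact: val_inj.
rewrite mulg1; split => //.
by move: nbs; rewrite /cons1 /=; case: eqVneq => //= _; rewrite negbK => /eqP.
Qed.

End first_letter.

Lemma preimage_seq (E' E : eqType) (phi : E' -> E) (F : seq E) :
  injective phi -> exists F' : seq E', forall e, (e \in F') = (phi e \in F).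
Proof.
move=> phiI; elim: F => [|e F [F' FF']]; first by exists [::].
have [[e' e'e]|ne] := pselect (exists e', phi e' = e).
  by exists (e' :: F') => e0; rewrite !inE FF' -e'e (inj_eq phiI).
exists F' => e0; rewrite inE FF'; case: eqVneq => // e0e.
by exfalso; apply: ne; exists e0.
Qed.

(** * Percolation on the free product *)

Section free_product_percolation.
Local Open Scope group_scope.
Context {I : choiceType} (G : I -> groupType) (S : forall i : I, set (G i)).
Arguments S : clear implicits.
Hypotheses (finI : finite_set [set: I]).
Hypotheses (finS : forall i, finite_set (S i)).
Hypotheses (genS : forall i, generates (S i)).

Definition free_generators : set (free_product G) :=
  \bigcup_i (embed G i @` S i).

Lemma embed_free_generators i s : S i s -> free_generators (embed G i s).
Proof. by move=> Ss; exists i => //; exists s. Qed.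

Lemma finite_free_generators : finite_set free_generators.
Proof. by apply: bigcup_finite => // i _; exact: finite_image. Qed.

Lemma embedV i (g : G i) : embed G i g^-1 = (embed G i g)^-1.
Proof. by apply: (mulgI (embed G i g)); rewrite -embedM !mulgV embed1. Qed.

Lemma generates_free_generators : generates free_generators.
Proof.
apply/seteqP; split=> // a _ A [[A1 AV] SA].
have AM g h : A g -> A h -> A (g * h).
  by move=> Ag Ah; rewrite -[h]invgK -[h^-1]mul1g; apply: (AV) => //; exact: AV.
suff AG i (g : G i) : A (embed G i g).
  apply: (free_product_ind (P := A)) => // i g b _ _ Ab.
  exact: AM (AG _ _) Ab.
have : setT `<=` [set g | A (embed G i g)].
  rewrite -(genS i); apply: smallest_sub => [|s Ss /=].
    split=> [|x y Ax Ay /=]; first by rewrite /= embed1.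
    by rewrite embedM embedV; exact: AV.
  exact/SA/embed_free_generators.
exact.
Qed.

Let finX := finite_free_generators.
Let genX := generates_free_generators.

Definition embed_generator i (s : S i) : free_generators :=
  SigSub (mem_set (embed_free_generators (set_mem (valP s)))).

Definition embed_edge i (e : edge (cayley (S i))) :
  edge (cayley free_generators) := (embed G i e.1, embed_generator e.2).

Lemma embed_edge_inj i : injective (@embed_edge i).
Proof.
move=> [g s] [h t] st; have := congr1 fst st; have := congr1 (val \o snd) st.
by move=> /embed_inj/val_inj /= -> /embed_inj /= ->.
Qed.

Lemma embed_edge_ends i (e : edge (cayley (S i))) :
  ends (embed_edge e) = (embed G i (ends e).1, embed G i (ends e).2).
Proof. by rewrite /= embedM. Qed.

(** The retraction contracts every edge outside the copy of [G i] through 1; this is the form in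
    which [walk_map] and [joined_map] use it. *)
Lemma first_letter_edge i (e : edge (cayley free_generators)) :
  first_letter i (ends e).1 = first_letter i (ends e).2 \/
  exists e' : edge (cayley (S i)), e = embed_edge e'.
Proof.
case: e => a t; have [j _ [s Ss st]] := set_mem (valP t).
have := first_letter_mul i a s; rewrite /= st => -[->|[ij aE]]; first by left.
right; move: aE; subst j; move=> aE.
exists (first_letter i a, SigSub (mem_set Ss)); rewrite /embed_edge /= -aE.
by congr (_, _); apply: val_inj; rewrite /= -st.
Qed.

Lemma first_letter_embed_edge i (e : edge (cayley (S i))) :
  (first_letter i (ends (embed_edge e)).1,
   first_letter i (ends (embed_edge e)).2) = ends e.
Proof.
by rewrite embed_edge_ends !first_letter_embed; case: (ends e).
Qed.

(** The embedding maps walks to walks, and the retraction [first_letter] brings them back without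
    lengthening them. *)
Lemma word_length_embed i (g : G i) :
  word_length free_generators (embed G i g) = word_length (S i) g.
Proof.
apply/eqP; rewrite eqn_leq; apply/andP; split.
  have [[s gs <-] _] := at_dist_word_length (genS i) g.
  have [|s' gs' s's] := @walk_map (cayley (S i)) (cayley free_generators)
    setT setT (embed G i) _ _ _ _ gs.
    by move=> e _; right; exists (embed_edge e) => //; exact: embed_edge_ends.
  by rewrite embed1 in gs'; exact: leq_trans (word_length_le genX gs') s's.
have [[s gs <-] _] := at_dist_word_length genX (embed G i g).
have [|s' gs' s's] := @walk_map (cayley free_generators) (cayley (S i))
    setT setT (first_letter i) _ _ _ _ gs.
  move=> e _; have [|[e' ->]] := first_letter_edge i e; first by left.
  by right; exists e' => //; rewrite first_letter_embed_edge.
rewrite first_letter_embed in gs'.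
exact: leq_trans (word_length_le (genS i) gs') s's.
Qed.

Lemma two_point_embed (R : realType) (p : R) i (g : G i) :
  (@two_point R (cayley (S i)) p 1%g g <=
   @two_point R (cayley free_generators) p 1%g (embed G i g))%E.
Proof.
rewrite -(embed1 G i).
apply: (@two_point_map _ (cayley free_generators) (cayley (S i)) (embed G i)
  (@embed_edge i)); [exact: cayley_exhaustible|exact: embed_edge_inj|].
exact: embed_edge_ends.
Qed.

(* The vertex embed G i g separates 1 from embed G i g * a. The two retractions,
   onto the copy of G i and onto what hangs at embed G i g, turn an open path
   into two open paths using disjoint sets of edges; trivial generators are
   discarded because their loops belong to several copies. *)
Lemma two_point_cut (R : realType) (p : R) i (g : G i) (a : free_product G) :
  g != 1 -> fresh i (val a) ->
  (@two_point R (cayley free_generators) p 1%g (embed G i g * a)%g <=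
   @two_point R (cayley (S i)) p 1%g g *
   @two_point R (cayley free_generators) p 1%g a)%E.
Proof.
move=> g1 fa; apply: two_point_le => [|F]; first exact: cayley_exhaustible.
have [F0 F0F] := preimage_seq F (@embed_edge_inj i).
(* [F1] and [F2] are the disjoint edge sets of the two paths: nontrivial edges of the copy of [G i],
   and all other edges of [F]. *)
pose F1 : seq (edge (cayley (S i))) := [seq e <- F0 | val e.2 != 1].
pose F2 := [seq e <- F | e \notin map (@embed_edge i) F1].
pose A1 := [set w : config (edge (cayley (S i))) |
  @joined (cayley (S i)) (restrict_config (mem F1) w) 1%g g].
pose A1' := [set w : config (edge (cayley free_generators)) |
  A1 (w \o (@embed_edge i))].
pose A2 := [set w : config (edge (cayley free_generators)) |
  @joined (cayley free_generators) (restrict_config (mem F2) w)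
    (embed G i g) (embed G i g * a)].
have dA1 : determined F1 A1.
  exact: (determined_restrict (P := fun w => joined w _ _)).
have dA2 : determined F2 A2.
  exact: (determined_restrict (P := fun w => joined w _ _)).
apply: (@le_trans _ _ (percolation p (A1' `&` A2))).
  apply: le_product_measure => w wg; split.
    have := @joined_map (cayley free_generators) (cayley (S i)) _
      (restrict_config (mem F1) (w \o @embed_edge i)) (first_letter i) _ _ _ wg.
    rewrite first_letter_embedM// first_letter1; apply => e /andP[we eF].
    have [|[e' ee']] := first_letter_edge i e; first by left.
    (* A trivial generator gives a loop, which the retraction may drop. *)
    have [s1|s1] := eqVneq (val e'.2) 1.
      left; move: (first_letter_embed_edge e'); rewrite -ee'.
      by case=> -> ->; rewrite s1 mulg1.
    right; exists e'; last by rewrite ee' first_letter_embed_edge.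
    apply/andP; split; first by rewrite /= -ee'.
    by rewrite /= mem_filter s1 F0F -ee'.
  (* The second retraction fixes what hangs at [embed G i g] and sends every other vertex to that
     cut vertex; in particular it moves 1 there, as [g] is nontrivial. *)
  pose f b := if first_letter i b == g then b else embed G i g.
  have f1 : f 1 = embed G i g by rewrite /f first_letter1 eq_sym (negbTE g1).
  have fga : f (embed G i g * a) = embed G i g * a.
    by rewrite /f first_letter_embedM// eqxx.
  have := @joined_map (cayley free_generators) (cayley free_generators) _
    (restrict_config (mem F2) w) f _ _ _ wg.
  rewrite f1 fga; apply => e /andP[we eF].
  have [ee|[e' ee']] := first_letter_edge i e.
    rewrite /f -ee; case: eqVneq => _; last by left.
    right; exists e; last by case: (ends e).
    apply/andP; split => //=; rewrite mem_filter eF andbT.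
    (* The endpoints of [e] have the same first letter, so an edge of the copy of [G i] equal to [e]
       would have a trivial generator, which [F1] excludes. *)
    apply/mapP => -[e']; rewrite mem_filter => /andP[/eqP s1 _] ee'; apply: s1.
    move: (first_letter_embed_edge e'); rewrite -ee' ee => -[-> e's].
    by apply: (mulgI e'.1); rewrite mulg1.
  (* Both endpoints lie in the copy of [G i], all of which [f] sends to [embed G i g]. *)
  left; rewrite ee' embed_edge_ends /f !first_letter_embed.
  by case: eqVneq => [->|_]; case: eqVneq => [->|_].
have dA1' := determined_marginal (phi := @embed_edge i) dA1.
rewrite /percolation (product_measure_indep _ dA1' dA2); last first.
  by move=> e eF1; rewrite mem_filter eF1.
rewrite (product_measure_marginal _ (@embed_edge_inj i) dA1).
apply: lee_pmul => //; first exact: two_point_ge.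
apply: le_trans (two_point_ge _ _ _ _) _.
have := translate_two_point finX genX p (embed G i g)^-1 (embed G i g)
  (embed G i g * a).
by rewrite mulVg mulKg.
Qed.

(** Induction on the number of letters, cutting off the first one each time. A constant [C] in the
    hypothesis would be raised to the number of letters, so constant 1 is essential; subadditivity
    of word length does the rest. *)
Lemma two_point_free_decay (R : realType) (p gamma : R) : (0 < gamma)%R ->
  (forall i (g : G i), @two_point R (cayley (S i)) p 1%g g <=
     (expR (- (gamma * (word_length (S i) g)%:R)))%:E)%E ->
  forall a, (@two_point R (cayley free_generators) p 1%g a <=
     (expR (- (gamma * (word_length free_generators a)%:R)))%:E)%E.
Proof.
move=> gamma0 decay; apply: free_product_ind.
  by rewrite (word_length1 genX) mulr0 oppr0 expR0 two_point_le1.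
move=> i g a g1 fa IH; apply: le_trans (two_point_cut p g1 fa) _.
apply: le_trans (lee_pmul (two_point_ge0 _ _ _) (two_point_ge0 _ _ _)
  (decay i g) IH) _.
rewrite -EFinM -expRD lee_fin ler_expR -opprD -mulrDr lerN2 ler_pM2l//.
rewrite -natrD ler_nat.
by rewrite -word_length_embed; exact: word_lengthM.
Qed.

End free_product_percolation.

(** * The critical point *)

Section critical_point.
Variable R : realType.

Lemma le_p_exp (X : multigraph) (p : R) :
  0 <= p <= 1 -> exp_decay X p -> p <= p_exp R X.
Proof. by move=> p01 dp; apply: ub_le_sup => //; exists 1 => q [/andP[]]. Qed.

Lemma p_exp_ge0 (X : multigraph) : 0 <= p_exp R X.
Proof.
rewrite /p_exp; set A := [set p : R | _].
have [->|/set0P[p [p01 dp]]] := eqVneq A set0; first by rewrite sup0.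
by have /andP[p0 _] := p01; exact: le_trans p0 (le_p_exp p01 dp).
Qed.

(** The hypothesis [0 <= c] covers an empty set of parameters, whose [sup] is 0 by default. *)
Lemma p_exp_le (X : multigraph) (c : R) : 0 <= c ->
  (forall p, 0 <= p <= 1 -> exp_decay X p -> p <= c) -> p_exp R X <= c.
Proof.
move=> c0 Xc; rewrite /p_exp; set A := [set p : R | _].
have [->|/set0P A0] := eqVneq A set0; first by rewrite sup0.
by apply: ge_sup => // p [p01 dp]; exact: Xc.
Qed.

(** Decay at some [q] above [p] passes down to [p], because two-point functions increase with the
    parameter. *)
Lemma exp_decay_lt_p_exp (X : multigraph) (p : R) : exhaustible (edge X) ->
  0 <= p < p_exp R X -> exp_decay X p.
Proof.
move=> EX /andP[p0 pX].
have [q [q01 [C [gamma [C0 gamma0 decay]]]] /ltW pq] :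
    exists2 q, (0 <= q <= 1 /\ exp_decay X q) & p < q.
  apply: sup_gt (pX).
  apply/set0P/eqP => A0; move: pX; rewrite /p_exp A0 sup0 => /(le_lt_trans p0).
  by rewrite ltxx.
exists C, gamma; split => // x y; apply: le_trans (decay x y).
have /andP[_ q1] := q01.
by apply: two_point_mono; rewrite // p0 (le_trans pq q1).
Qed.

(** On a finite group decay holds even at [p = 1], so the convention agrees with the supremum and
    finite factors need no separate treatment. *)
Lemma p_exp_groupE (G : groupType) (S : set G) : generates S ->
  finite_set S -> p_exp_group R S = p_exp R (cayley S).
Proof.
move=> genS finS; rewrite /p_exp_group; case: asboolP => // finG.
apply/esym/eqP; rewrite eq_le p_exp_le//=; last by move=> p /andP[].
by apply: le_p_exp; [rewrite ler01 lexx|exact: exp_decay_finite].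
Qed.

End critical_point.

Theorem proposition6 (R : realType) (n : nat) (G : 'I_n.+1 -> groupType)
    (S : forall i : 'I_n.+1, set (G i))
    (finS : forall i : 'I_n.+1, finite_set (S i))
    (genS : forall i : 'I_n.+1, generates (S i)) :
  p_exp R (cayley (\bigcup_i (embed G i @` S i))) =
  \big[Num.min/p_exp_group R (S ord0)]_(i < n.+1) p_exp_group R (S i).
Proof.
have finI : finite_set [set: 'I_n.+1] by exact: finite_finset.
have finX := finite_free_generators finI finS.
have genX := generates_free_generators genS.
rewrite -/(free_generators S) in finX genX *.
set X := cayley _.
under eq_bigr do rewrite p_exp_groupE//.
rewrite p_exp_groupE//; set m := \big[_/_]_(_ < _) _.
have m_le i : m <= p_exp R (cayley (S i)) by exact: bigmin_le.
apply/eqP; rewrite eq_le; apply/andP; split.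
  (* Decay on the free product restricts to each factor, with the same constants, along the
     isometric embedding. *)
  have X_le i : p_exp R X <= p_exp R (cayley (S i)).
    apply: p_exp_le => [|p p01]; first exact: p_exp_ge0.
    move=> /(exp_decay_cayleyP finX genX)[C [gamma [C0 gamma0 decay]]].
    apply: le_p_exp => //.
    apply/exp_decay_cayleyP => //; exists C, gamma; split => // g.
    rewrite -word_length_embed//.
    exact: le_trans (two_point_embed finS genS p g) (decay _).
  by apply: le_bigmin.
(* Otherwise a parameter [p] strictly between the two sides has decay on every factor, hence on the
   free product, which contradicts the supremum. *)
rewrite leNgt; apply/negP => Xm.
pose p := (p_exp R X + m) / 2.
have p0 : 0 <= p_exp R X := p_exp_ge0 R X.
have [Xp pm] : p_exp R X < p /\ p < m by rewrite /p; split; lra.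
(* This gives [p < 1], as [exp_decay_constant1] requires. *)
have m1 : m <= 1.
  apply: le_trans (m_le ord0) _; apply: p_exp_le => //.
  by move=> q /andP[].
have p01 : 0 <= p < 1 by rewrite (le_trans p0 (ltW Xp)) (lt_le_trans pm m1).
suff dp : exp_decay X p.
  have : p <= p_exp R X.
    by apply: le_p_exp dp; have /andP[-> /ltW] := p01.
  by rewrite leNgt Xp.
have decay i : exists2 gamma : R, 0 < gamma & forall g : G i,
    (@two_point R (cayley (S i)) p 1%g g <=
     (expR (- (gamma * (word_length (S i) g)%:R)))%:E)%E.
  apply: exp_decay_constant1 => //; apply: exp_decay_lt_p_exp.
    exact: cayley_exhaustible.
  by rewrite (le_trans p0 (ltW Xp)) (lt_le_trans pm).
pose gamma i := sval (cid2 (decay i)).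
have gammaP i : 0 < gamma i by rewrite /gamma; case: cid2.
(* A common rate for the finitely many factors; the default 1 can only lower the minimum and keeps
   it positive. *)
pose gamma0 := \big[Num.min/1]_(i < n.+1) gamma i.
have gamma00 : 0 < gamma0 by apply/bigmin_gtP; split.
apply/exp_decay_cayleyP => //; exists 1, gamma0; split => // a.
rewrite mul1r; apply: two_point_free_decay => // i g.
apply: (@le_trans _ _ (expR (- (gamma i * (word_length (S i) g)%:R)))%:E).
  by rewrite /gamma; case: cid2.
by rewrite lee_fin ler_expR lerN2 ler_wpM2r// bigmin_le.
Qed.
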